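(* Let $0<r<1$ and $1\le p<\infty$. Gurarii's modulus of convexity of the normed space $t_p^r$ satisfies $$\beta_{t_p^r}(\theta)\le 1-\Big[1-\Big(\frac{\theta}{2}\Big)^p\Big]^{1/p}\qquad\text{for all } 0\le\theta\le 2.$$
   Context: Let $\mathbb{N}=\{0,1,2,\dots\}$ and let $\omega$ be the linear space of all (real or complex) sequences $x=(x_k)_{k\in\mathbb{N}}$. For $0<r<1$ the Taylor transform $T(r)x$ of $x\in\omega$ is the sequence with terms $$(T(r)x)_n=\sum_{k=n}^{\infty}\binom{k}{n}(1-r)^{n+1}r^{k-n}x_k\qquad(n\in\mathbb{N}),$$ whenever all these series converge. For $1\le p<\infty$ let $$t_p^r=\Big\{x\in\omega:\ \sum_{n}\Big|\sum_{k=n}^{\infty}\binom{k}{n}(1-r)^{n+1}r^{k-n}x_k\Big|^p<\infty\Big\},$$ equipped with the norm $\|x\|_{t_p^r}=\|T(r)x\|_{\ell_p}$. For a normed space $X$ with unit sphere $S(X)$, Gurarii's modulus of convexity is, for $0\le\theta\le 2$, $$\beta_X(\theta)=\inf\Big\{1-\inf_{\alpha\in[0,1]}\|\alpha x+(1-\alpha)y\|:\ x,y\in S(X),\ \|x-y\|=\theta\Big\}.$$ *)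

(* Defs.v *)
From HB Require Import structures.
From mathcomp Require Import all_boot all_order all_algebra.
From mathcomp Require Import all_classical all_reals all_analysis.
From mathcomp Require Import complex.

Set Implicit Arguments.
Unset Strict Implicit.
Unset Printing Implicit Defensive.

Import Order.TTheory GRing.Theory Num.Theory.
Import numFieldNormedType.Exports.

Local Open Scope classical_set_scope.
Local Open Scope ring_scope.

(* [Rcomplex R] is the alias of [R[i]] carrying its structure over [R]: real
   scaling and the [R]-valued modulus.  The library stops at the normed
   Z-module; the instances below add the topology of the modulus. *)
HB.instance Definition _ (R : realType) :=
  PseudoMetric.copy (Rcomplex R) (pseudoMetric_normed (Rcomplex R)).
HB.instance Definition _ (R : realType) := isPointed.Build (Rcomplex R) 0.
HB.instance Definition _ (R : realType) :=
  NormedZmod_PseudoMetric_eq.Build R (Rcomplex R) erefl.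

Fact Rcomplex_normrZ (R : realType) (a : R) (x : Rcomplex R) :
  `|a *: x| = `|a| * `|x|.
Proof.
case: x => u v; rewrite /Num.norm /= !exprMn -mulrDr sqrtrM ?sqr_ge0//.
by rewrite sqrtr_sqr.
Qed.

HB.instance Definition _ (R : realType) :=
  PseudoMetricNormedZmod_Lmodule_isNormedModule.Build R (Rcomplex R)
    (@Rcomplex_normrZ R).

(* Sequences take their values in [V], where [V := R^o] gives the real
   sequences and [V := Rcomplex R] the complex ones; the matrix of the
   transform is real, so it acts by the scaling of [V] over [R]. *)
Definition taylor_coef (R : realType) (r : R) (n k : nat) : R :=
  'C(k, n)%:R * (1 - r) ^+ n.+1 * r ^+ (k - n).

Definition taylor_defined (R : realType) (V : normedModType R) (r : R)
    (x : nat -> V) : Prop :=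
  forall n : nat,
    cvgn (fun N : nat => \sum_(n <= k < N) taylor_coef r n k *: x k).

(* Meaningful only when [taylor_defined r x]; divergent series get a default
   value. *)
Definition taylor (R : realType) (V : normedModType R) (r : R)
    (x : nat -> V) : nat -> V :=
  fun n => limn (fun N : nat => \sum_(n <= k < N) taylor_coef r n k *: x k).

Definition taylor_space (R : realType) (V : normedModType R) (r p : R) :
    set (nat -> V) :=
  [set x | taylor_defined r x /\
           (\sum_(n <oo) (`|taylor r x n| `^ p)%:E < +oo)%E].

Definition taylor_norm (R : realType) (V : normedModType R) (r p : R)
    (x : nat -> V) : R :=
  fine (Lnorm counting p%:E (fun n : nat => `|taylor r x n|%:E)).

(* The space is given by its carrier [X] in an ambient linear space [E] and by
   the function [nrm] on it.  Infima are taken in [\bar R], so that an infimum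
   over the empty set is [+oo] and not a default real. *)
Definition unit_sphere (R : realType) (E : lmodType R) (X : set E)
    (nrm : E -> R) : set E := [set x | X x /\ nrm x = 1].

Definition gurarii_modulus (R : realType) (E : lmodType R) (X : set E)
    (nrm : E -> R) (theta : R) : \bar R :=
  ereal_inf [set b : \bar R | exists x y : E,
    [/\ unit_sphere X nrm x, unit_sphere X nrm y, nrm (x - y) = theta &
        b = (1 - ereal_inf [set (nrm (a *: x + (1 - a) *: y))%:E
                           | a in `[0%R, 1%R]])%E]].

(* Main.v *)
Require Import Defs.
From HB Require Import structures.
From mathcomp Require Import all_boot all_order all_algebra.
From mathcomp Require Import all_classical all_reals all_analysis.
From mathcomp Require Import complex ring.

Set Implicit Arguments.
Unset Strict Implicit.
Unset Printing Implicit Defensive.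

Import Order.TTheory GRing.Theory Num.Theory.
Import numFieldNormedType.Exports.

Local Open Scope classical_set_scope.
Local Open Scope ring_scope.

(** An upper bound for an infimum only needs one pair of points.  In the plane
    of the first two coordinates of [ell_p], put [s := theta / 2] and
    [u := (1 - s `^ p) `^ p^-1]; the vectors [(u, s)] and [(u, - s)] have norm
    [1], they are [2 s = theta] apart, and every point [(u, (2 a - 1) s)] of the
    segment between them has norm at least [u], so that they show
    [beta theta <= 1 - u].

    The pair has to be moved into the Taylor space.  The matrix of the transform
    is upper triangular with nonzero diagonal, so its restriction to the
    sequences supported on [{0, 1}], for which all the series are finite sums,
    is an invertible [2 x 2] system.  Its solution [taylor_preimage2] sends
    [(a, b)] linearly to a sequence with transform [(a, b, 0, 0, ...)]
    ([taylor_preimage2K]), whose norm is therefore the [ell_p] norm of [(a, b)]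
    ([taylor_norm_preimage2]).  Only a unit vector of the scalars is used, which
    treats the real and the complex case at once. *)

(** Backward substitution in
    [(1 - r) x_0 + (1 - r) r x_1 = a] and [(1 - r)^2 x_1 = b]. *)
Definition taylor_preimage2 (R : realType) (V : normedModType R) (r : R)
    (a b : V) : nat -> V :=
  fun k => match k with
  | 0 => (1 - r)^-1 *: a - (r / (1 - r) ^+ 2) *: b
  | 1 => ((1 - r) ^+ 2)^-1 *: b
  | _ => 0
  end.

(** Differences and convex combinations of the chosen sequences stay in the same
    two-dimensional family, where their norms are explicit. *)
Lemma taylor_preimage2_linear (R : realType) (V : normedModType R)
    (r c d : R) (a b a' b' : V) :
  c *: taylor_preimage2 r a b + d *: taylor_preimage2 r a' b' =
  taylor_preimage2 r (c *: a + d *: a') (c *: b + d *: b').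
Proof.
apply/funext => -[|[|k]] /=; rewrite !fctE/=.
- rewrite !scalerBr !scalerDr !scalerA opprD addrACA.
  by rewrite !(mulrC c) !(mulrC d).
- by rewrite scalerDr !scalerA !(mulrC c) !(mulrC d).
- by rewrite !scaler0 addr0.
Qed.

(** The partial sums are stationary from [m] on. *)
Lemma cvg_taylor_finite_support (R : realType) (V : normedModType R) (r : R)
    (x : nat -> V) (m n : nat) : (forall k, (m <= k)%N -> x k = 0) ->
  (fun N : nat => \sum_(n <= k < N) taylor_coef r n k *: x k) @ \oo -->
  \sum_(n <= k < m) taylor_coef r n k *: x k.
Proof.
move=> x0; apply: cvg_near_cst; exists m => // N /= mN.
rewrite [RHS](big_nat_widen _ _ _ _ _ mN) [RHS]big_mkcond/=.
apply: eq_bigr => k _; case: ltnP => // mk.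
by rewrite x0// scaler0.
Qed.

Lemma taylor_preimage2K (R : realType) (V : normedModType R) (r : R)
    (a b : V) : r != 1 ->
  taylor_defined r (taylor_preimage2 r a b) /\
  taylor r (taylor_preimage2 r a b) =
    fun n => match n with 0 => a | 1 => b | _ => 0 end.
Proof.
move=> r1; have r1' : 1 - r != 0 by rewrite subr_eq0 eq_sym.
have cvg n := @cvg_taylor_finite_support R V r (taylor_preimage2 r a b) 2 n.
have supp k : (2 <= k)%N -> taylor_preimage2 r a b k = 0 by case: k => [|[]].
split; first by move=> n; apply/cvg_ex; eexists; exact: cvg supp.
apply/funext => n; rewrite /taylor (cvg_lim _ (cvg n supp))//.
case: n => [|[|n]]; last by rewrite big_geq.
- rewrite big_nat_recl// big_nat1/= /taylor_coef !bin0 subn0 scalerBr !scalerA.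
  rewrite -addrA -scaleNr -scalerDl [X in X *: a](_ : _ = 1); last by field.
  by rewrite [X in X *: b](_ : _ = 0) ?scale0r ?addr0 ?scale1r//; field.
- rewrite big_nat1/= /taylor_coef scalerA.
  by rewrite [X in X *: b](_ : _ = 1) ?scale1r// binn subnn; field.
Qed.

Lemma nneseries_powR_two_terms (R : realType) (V : normedModType R) (p : R)
    (a b : V) : 0 < p ->
  (\sum_(n <oo) (`|match n with 0 => a | 1 => b | _ => 0 end| `^ p)%:E =
   (`|a| `^ p + `|b| `^ p)%:E)%E.
Proof.
move=> p0; rewrite (nneseries_split 0 2); last first.
  by move=> k _; rewrite lee_fin powR_ge0.
rewrite add0n eseries0 ?adde0; last first.
  by move=> [|[|k]]// _ _; rewrite normr0 powR0// gt_eqF.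
by rewrite big_nat_recl// big_nat1 EFinD.
Qed.

Lemma taylor_space_preimage2 (R : realType) (V : normedModType R) (r p : R)
    (a b : V) : r != 1 -> 0 < p -> taylor_space r p (taylor_preimage2 r a b).
Proof.
move=> r1 p0; have [d e] := @taylor_preimage2K R V r a b r1; split => //.
by rewrite e nneseries_powR_two_terms// ltry.
Qed.

Lemma taylor_norm_preimage2 (R : realType) (V : normedModType R) (r p : R)
    (a b : V) : r != 1 -> 0 < p ->
  taylor_norm r p (taylor_preimage2 r a b) =
  (`|a| `^ p + `|b| `^ p) `^ p^-1.
Proof.
move=> r1 p0; have [_ e] := @taylor_preimage2K R V r a b r1.
rewrite /taylor_norm e Lnorm_counting//=.
under eq_eseriesr do rewrite normr_id.
by rewrite nneseries_powR_two_terms.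
Qed.

Lemma gurarii_modulus_le (R : realType) (E : lmodType R) (X : set E)
    (nrm : E -> R) (x y : E) (u : R) :
  unit_sphere X nrm x -> unit_sphere X nrm y ->
  (forall a, 0 <= a <= 1 -> u <= nrm (a *: x + (1 - a) *: y)) ->
  (gurarii_modulus X nrm (nrm (x - y)%R) <= (1 - u)%:E)%E.
Proof.
move=> Sx Sy le_u; rewrite /gurarii_modulus.
apply: (@le_trans _ _ (1 - ereal_inf [set (nrm (a *: x + (1 - a) *: y)%R)%:E
                                     | a in `[0%R, 1%R]])%E).
  by apply: ereal_inf_lbound; exists x, y.
rewrite EFinB leeB//; apply: le_ereal_inf_tmp => _ [a /= + <-].
by rewrite in_itv/= lee_fin => /le_u.
Qed.

(** Up to the unit vector [v], the points are the preimages [x] and [y] of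
    [(u, s)] and [(u, - s)]; passing from one to the other only changes the
    second coordinate, so the first one bounds the norm of the whole segment
    from below. *)
Lemma gurarii_modulus_taylor_le (R : realType) (V : normedModType R)
    (r p theta : R) (v : V) : r != 1 -> 0 < p -> 0 <= theta <= 2 ->
  `|v| = 1 ->
  (gurarii_modulus (taylor_space (V := V) r p) (taylor_norm r p) theta
     <= (1 - (1 - (theta / 2) `^ p) `^ p^-1)%:E)%E.
Proof.
move=> r1 p0 /andP[t0 t2] v1.
set s := theta / 2; set u := (1 - s `^ p) `^ p^-1.
have s0 : 0 <= s by rewrite /s divr_ge0.
have sp1 : s `^ p <= 1.
  have : s <= 1 by rewrite /s ler_pdivrMr// mul1r.
  move=> /(@ge0_ler_powR _ p (ltW p0) _ _); rewrite powR1; apply=> //.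
  by rewrite nnegrE.
have u0 : 0 <= u by exact: powR_ge0.
have pV : p^-1 * p = 1 by rewrite mulVf// gt_eqF.
have pV' : p * p^-1 = 1 by rewrite mulrC.
have up : u `^ p = 1 - s `^ p by rewrite /u -powRrM pV powRr1// subr_ge0.
have nZ c : `|c *: v| = `|c| by rewrite normrZ v1 mulr1.
have Sphere c : `|c| = s ->
    unit_sphere (taylor_space (V := V) r p) (taylor_norm r p)
      (taylor_preimage2 r (u *: v) (c *: v)).
  move=> cs; split; first exact: taylor_space_preimage2.
  by rewrite taylor_norm_preimage2// !nZ cs ger0_norm// up subrK powR1.
set x := taylor_preimage2 r (u *: v) (s *: v).
set y := taylor_preimage2 r (u *: v) ((- s) *: v).
have <- : taylor_norm r p (x - y) = theta.
  rewrite -[x]scale1r -scaleN1r taylor_preimage2_linear !scalerA -!(scalerDl v).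
  rewrite taylor_norm_preimage2// !nZ !mul1r !mulN1r subrr normr0 powR0 ?gt_eqF//.
  rewrite add0r -powRrM pV' powRr1// opprK ger0_norm ?addr_ge0//.
  by rewrite /s; field.
apply: gurarii_modulus_le.
- by apply: Sphere; rewrite ger0_norm.
- by apply: Sphere; rewrite normrN ger0_norm.
move=> a _; rewrite taylor_preimage2_linear !scalerA -!(scalerDl v).
rewrite taylor_norm_preimage2// !nZ -mulrDl [a + _]addrC subrK mul1r.
(* [u] becomes [(u `^ p) `^ p^-1], the norm with the second coordinate erased. *)
rewrite (ger0_norm u0) -[leLHS]powRr1// -pV' powRrM.
apply: ge0_ler_powR; rewrite ?invr_ge0 ?(ltW p0)// ?nnegrE ?addr_ge0 ?powR_ge0//.
by rewrite lerDl powR_ge0.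
Qed.

Theorem theorem3p5 (R : realType) (r p theta : R)
    (hr0 : 0 < r) (hr1 : r < 1) (hp : 1 <= p)
    (ht0 : 0 <= theta) (ht2 : theta <= 2) :
  (gurarii_modulus (taylor_space (V := R^o) r p) (taylor_norm r p) theta
     <= (1 - (1 - (theta / 2) `^ p) `^ p^-1)%:E)%E
  /\
  (gurarii_modulus (taylor_space (V := Rcomplex R) r p) (taylor_norm r p) theta
     <= (1 - (1 - (theta / 2) `^ p) `^ p^-1)%:E)%E.
Proof.
have r1 : r != 1 by rewrite lt_eqF.
have p0 : 0 < p by exact: lt_le_trans hp.
split; [apply: (@gurarii_modulus_taylor_le R R^o r p theta 1) |
        apply: (@gurarii_modulus_taylor_le R (Rcomplex R) r p theta
                                            (1 : R[i]))];
  rewrite ?ht0//.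
- exact: normr1.
- by rewrite /Num.norm/= expr1n expr0n/= addr0 sqrtr1.
Qed.
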